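(* Let $n\in\mathbb N$ and put $k=\lfloor\frac n2\rfloor$. Then $$e(\mathcal B_n)=\sum_{\mu\vdash n}\frac{n!}{\prod_{i=1}^n\mu_i!\cdot\prod_{j=1}^k(2j)^{\mu_{2j}}}.$$ If $0\le r\le n$, then $$e(D_r(\mathcal B_n))=\sum_{\substack{\mu\vdash n\\ \mu_1+\mu_3+\cdots=r}}\frac{n!}{\prod_{i=1}^n\mu_i!\cdot\prod_{j=1}^k(2j)^{\mu_{2j}}}.$$
   Context: $\mathbb N=\{0,1,2,\dots\}$. Write $\mathbf n=\{1,\dots,n\}$ and let $\mathbf n'$ be a disjoint copy. The Brauer monoid $\mathcal B_n$ is the set of all set partitions $\alpha$ of $\mathbf n\cup\mathbf n'$ into blocks of size exactly $2$ ($\mathcal B_0=\{\emptyset\}$). Product: for $\alpha,\beta\in\mathcal B_n$ take a third copy $\mathbf n''$; relabel each lower vertex $x'$ of $\alpha$ as $x''$ and each upper vertex $x$ of $\beta$ as $x''$, and take the union graph $\Gamma(\alpha,\beta)$ on $\mathbf n\cup\mathbf n'\cup\mathbf n''$ (blocks being viewed as edges); $x,y\in\mathbf n\cup\mathbf n'$ are in the same block of $\alpha\beta$ iff they are joined by a path in $\Gamma(\alpha,\beta)$. The rank of $\alpha$ is the number of blocks meeting both $\mathbf n$ and $\mathbf n'$, and $D_r(\mathcal B_n)=\{\alpha\in\mathcal B_n:\operatorname{rank}(\alpha)=r\}$. For $\Sigma\subseteq\mathcal B_n$, $e(\Sigma)$ is the number of $\alpha\in\Sigma$ with $\alpha^2=\alpha$.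 $\mu\vdash n$ means $\mu$ is an integer partition of $n$, and $\mu_i$ denotes the number of parts of $\mu$ equal to $i$; $\mu_1+\mu_3+\cdots$ is the number of odd parts. *)

(* Defs.v *)
From mathcomp Require Import all_boot.

Set Implicit Arguments.
Unset Strict Implicit.
Unset Printing Implicit Defensive.

(* The vertex set n \cup n': [inl i] is the upper vertex i and [inr i] the
   lower vertex i'; indices run over {0, .., n-1} instead of {1, .., n}. *)
Definition vertex (n : nat) : finType := ('I_n + 'I_n)%type.

Definition brauer (n : nat) : {set {set {set vertex n}}} :=
  [set a | partition a [set: vertex n] & [forall A in a, #|A| == 2]].

(* The vertex set n \cup n' \cup n'' of the union graph: the n \cup n' part is
   [inl], and [inr i] is the vertex i''. *)
Definition vertex3 (n : nat) : finType := (vertex n + 'I_n)%type.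

Definition lower_to_middle (n : nat) (x : vertex n) : vertex3 n :=
  match x with inl i => inl (inl i) | inr i => inr i end.

Definition upper_to_middle (n : nat) (x : vertex n) : vertex3 n :=
  match x with inl i => inr i | inr i => inl (inr i) end.

Definition union_edges (n : nat) (a b : {set {set vertex n}}) :
    {set {set vertex3 n}} :=
  [set @lower_to_middle n @: A | A : {set vertex n} in a] :|:
  [set @upper_to_middle n @: B | B : {set vertex n} in b].

(* [connect] is the reflexive transitive closure, i.e. being joined by a path.
   The definition makes sense for arbitrary families of sets, but it is meant
   for (and only used on) elements of [brauer n]. *)
Definition brauer_mul (n : nat) (a b : {set {set vertex n}}) :
    {set {set vertex n}} :=
  equivalence_partition
    (fun x y : vertex n =>
       connect [rel u v : vertex3 n | [set u; v] \in union_edges a b]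
               (inl x) (inl y))
    [set: vertex n].

Definition upper (n : nat) : {set vertex n} := [set inl i | i : 'I_n].
Definition lower (n : nat) : {set vertex n} := [set inr i | i : 'I_n].

Definition rank (n : nat) (a : {set {set vertex n}}) : nat :=
  #|[set A in a | (A :&: upper n != set0) && (A :&: lower n != set0)]|.

Definition brauer_rank (n r : nat) : {set {set {set vertex n}}} :=
  [set a in brauer n | rank a == r].

Definition num_idem (n : nat) (S : {set {set {set vertex n}}}) : nat :=
  #|[set a in S | brauer_mul a a == a]|.

Definition is_intpart (n : nat) (s : seq nat) : bool :=
  [&& sorted geq s, 0 \notin s & sumn s == n].

(* A partition of n has at most n parts, each at most n; bounding the length
   and the entries only serves to obtain a finite type (see [intpart_onto]). *)
Definition intpart (n : nat) : finType :=
  {s : n.-bseq 'I_n.+1 | is_intpart n [seq val i | i <- s]}%type.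

Definition parts (n : nat) (mu : intpart n) : seq nat :=
  [seq val i | i <- val mu].

Definition mult (n : nat) (mu : intpart n) (i : nat) : nat :=
  count_mem i (parts mu).

Lemma partsP (n : nat) (mu : intpart n) : is_intpart n (parts mu).
Proof. exact: (valP mu). Qed.

Lemma parts_inj (n : nat) : injective (@parts n).
Proof.
move=> mu nu eq_parts; apply/val_inj/val_inj.
exact: (inj_map val_inj eq_parts).
Qed.

Lemma intpart_onto (n : nat) (s : seq nat) :
  is_intpart n s -> exists mu : intpart n, parts mu = s.
Proof.
move=> s_part; have /and3P[_ s_pos /eqP sum_s] := s_part.
have le_size : size s <= n.
  rewrite -sum_s; elim: s s_pos {s_part sum_s} => //= x s IHs.
  rewrite inE negb_or => /andP[x_neq0 /IHs le_s].
  by rewrite -add1n leq_add // lt0n eq_sym.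
have le_part : {in s, forall x, x < n.+1}.
  move=> x; rewrite -sum_s ltnS; elim: s {s_part s_pos sum_s le_size} => //= y s IHs.
  rewrite inE => /orP[/eqP-> | /IHs le_x]; first exact: leq_addr.
  exact: leq_trans le_x (leq_addl _ _).
pose t := [seq (inord i : 'I_n.+1) | i <- s].
have val_t : [seq val i | i <- t] = s.
  rewrite -map_comp -[RHS]map_id; apply/eq_in_map => x /le_part lt_x.
  by rewrite /= inordK.
have le_t : size t <= n by rewrite size_map.
have t_part : is_intpart n [seq val i | i <- Bseq le_t] by rewrite /= val_t.
by exists (exist _ (Bseq le_t) t_part).
Qed.

(* Main.v *)
Require Import Defs.
From mathcomp Require Import all_boot all_order all_fingroup all_algebra.
From mathcomp Require Import ring.

(** A Brauer diagram is a fixed-point-free involution [s] of the vertices, the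
two copies [inl i] and [inr i] of a point forming its column. Draw a graph on
the columns by joining those of [v] and [s v]. The diagram is idempotent exactly
when no two through blocks lie in one component of this graph
([idem_separated], [separated_idem]). In one direction, the middle vertices of
the product graph of an idempotent give a labelling of the columns that is
constant on components and distinguishes the through blocks. In the other, such
a labelling shows that distinct blocks stay apart in the square, and a parity
count (every component of the product graph has an even number of end points)
shows that the two ends of a block stay together.

Let X(n, r) be the number of idempotents of rank r on n columns. Removing an
upper block {x, y} together with the lower vertices x', y' and joining their
former partners leaves an idempotent of the same rank on n - 2 columns.
Conversely, y' can be joined to x', to one of the n - 2 other lower vertices, or
to the upper end of one of the r through blocks, and x' then takes the former
partner of that vertex; an upper vertex whose partner is also upper is excluded
because it would give two through blocks in one component. Each diagram of rank
r has n - r upper vertices in upper blocks, so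
      (n - r) X(n, r) = n (n - 1) (n - 1 + r) X(n - 2, r),
while X(r, r) = 1, the identity diagram ([diagrams_rec],
[card_diagrams_full]).

Divide the right-hand side of the theorem by n! and call the result F(n, r): it
is the sum, over partitions mu of n with r odd parts, of the weight W(mu), the
product over the part sizes i of w_i ^ m_i / m_i!, with m_i the multiplicity,
w_i = 1 for odd i and w_i = 1 / i for even i. Removing one part of size i gives, for every function g,
      sum over mu of (sum over parts i of g i) W(mu)
        = sum over i of g(i) w_i F(n - i, r - [i odd]).
Taking g(i) = i - [i odd] for n + 2 and g(i) = i + [i odd] for n, the two right
sides agree up to a shift of i by 2 and one extra term F(n, r); this is
      (n + 2 - r) F(n + 2, r) = (n + 1 + r) F(n, r)
([intpart_sum_rec]). Hence X(n, r) and n! F(n, r) satisfy the same recurrence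
with the same initial values ([card_diagrams]). *)

Set Implicit Arguments.
Unset Strict Implicit.
Unset Printing Implicit Defensive.

Import Order.TTheory GRing.Theory Num.Theory.

(** * Brauer diagrams as involutions *)

Definition column (T : Type) (v : T + T) : T :=
  match v with inl i => i | inr i => i end.

Definition is_lower (T : Type) (v : T + T) : bool :=
  if v is inr _ then true else false.

Definition through (T : finType) (s : {perm T + T}) (i : T) : bool :=
  is_lower (s (inl i)).

(** No component of the graph joining the columns of [v] and [s v] contains two
through blocks. A labelling [c] that is constant on components replaces the
components themselves: it can be carried along explicitly when blocks are added
or removed, so that no path has to be followed. *)
Definition separated (T : finType) (s : {perm T + T}) : bool :=
  [exists c : {ffun T -> T},
     [forall v, c (column (s v)) == c (column v)] &&
     [forall i, forall j,
        [&& through s i, through s j & c i == c j] ==> (i == j)]].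

Lemma separatedE (T : finType) (s : {perm T + T}) :
  separated s ->
  exists c : T -> T, (forall v, c (column (s v)) = c (column v)) /\
    (forall i j, through s i -> through s j -> c i = c j -> i = j).
Proof.
case/existsP=> c /andP[/forallP cs /forallP c_inj]; exists c; split.
  by move=> v; apply/eqP.
move=> i j ti tj cij; apply/eqP; have /forallP/(_ j)/implyP := c_inj i.
by apply; rewrite ti tj cij eqxx.
Qed.

(** Labels may come from any type: replacing each label by a canonical column
carrying it yields labels in [T]. *)
Lemma separatedI (T : finType) (L : eqType) (c : T -> L) (s : {perm T + T}) :
  (forall v, c (column (s v)) = c (column v)) ->
  (forall i j, through s i -> through s j -> c i = c j -> i = j) ->
  separated s.
Proof.
move=> cs c_inj; pose d := [ffun i => odflt i [pick j | c j == c i]].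
have cd i : c (d i) = c i.
  by rewrite ffunE; case: pickP => [j /eqP|/(_ i)] //=; rewrite eqxx.
have dc i j : c i = c j -> d i = d j.
  move=> cij; rewrite !ffunE (@eq_pick _ _ (fun k => c k == c j)); last first.
    by move=> k /=; rewrite cij.
  by case: pickP => [k|/(_ j)] //=; rewrite eqxx.
apply/existsP; exists d; apply/andP; split.
  by apply/forallP=> v; apply/eqP/dc/cs.
apply/forallP=> i; apply/forallP=> j; apply/implyP=> /and3P[ti tj /eqP dij].
by apply/eqP/c_inj => //; rewrite -cd dij cd.
Qed.

Definition fpf_involution (V : finType) (s : {perm V}) : bool :=
  [forall v, s (s v) == v] && [forall v, s v != v].

Lemma fpf_involutionP (V : finType) (s : {perm V}) :
  reflect (involutive s /\ forall v, s v != v) (fpf_involution s).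
Proof.
apply: (iffP andP) => [[/forallP i /forallP f]|[i f]].
  by split=> // v; apply/eqP.
by split; apply/forallP=> v //; apply/eqP/i.
Qed.

Definition blocks (V : finType) (s : {perm V}) : {set {set V}} :=
  [set [set v; s v] | v : V].

Lemma mem_blocks (V : finType) (s : {perm V}) (v : V) : [set v; s v] \in blocks s.
Proof. exact: imset_f. Qed.

Lemma block_of (V : finType) (s : {perm V}) (A : {set V}) (v : V) :
  involutive s -> A \in blocks s -> v \in A -> A = [set v; s v].
Proof.
move=> sK /imsetP[w _ ->]; rewrite !inE => /orP[/eqP->//|/eqP->].
by rewrite sK setUC.
Qed.

Lemma blocks_inj (V : finType) (s t : {perm V}) :
  fpf_involution s -> fpf_involution t -> blocks s = blocks t -> s = t.
Proof.
move=> /fpf_involutionP[sK sF] /fpf_involutionP[tK tF] st; apply/permP=> v.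
have := mem_blocks s v; rewrite st => /(block_of tK)/(_ (set21 _ _)) /setP/(_ (s v)).
by rewrite !inE eqxx orbT (negPf (sF v)) /= => /esym/eqP.
Qed.

Lemma blocks_equivalence (V : finType) (s : {perm V}) :
  blocks s = equivalence_partition (fun x y => y \in [set x; s x]) [set: V].
Proof.
rewrite /equivalence_partition; apply/setP=> A.
by apply/imsetP/imsetP=> -[v _ ->]; exists v => //; apply/setP=> y; rewrite !inE.
Qed.

(** The involution sends a vertex to the other element of its block. *)
Lemma brauer_blocks (n : nat) :
  brauer n = [set blocks s | s : {perm vertex n} in @fpf_involution (vertex n)].
Proof.
apply/setP=> a; rewrite inE; apply/idP/imsetP=> [|[s /fpf_involutionP[sK sF] ->]].
  case/andP=> a_part /forall_inP a2.
  have [/eqP cov_a triv_a a0] := and3P a_part.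
  have pb v : pblock a v \in a by rewrite pblock_mem // cov_a inE.
  have vpb v : v \in pblock a v by rewrite mem_pblock cov_a inE.
  have ex v : exists w, (w != v) && (pblock a v == [set v; w]).
    have /cards2P[x [y [xy e]]] := a2 _ (pb v).
    have := vpb v; rewrite e !inE => /orP[/eqP->|/eqP->].
      by exists y; rewrite eq_sym xy eqxx.
    by exists x; rewrite xy setUC eqxx.
  pose f v := xchoose (ex v).
  have fN v : f v != v by case/andP: (xchooseP (ex v)).
  have fE v : pblock a v = [set v; f v] by case/andP: (xchooseP (ex v)) => _ /eqP.
  have fK : involutive f.
    move=> v; have e : pblock a (f v) = pblock a v.
      by apply/esym/eqP; rewrite eq_pblock ?cov_a ?inE // fE set22.
    have := vpb v; rewrite -e fE !inE eq_sym (negPf (fN v)) /= => /eqP e'.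
    by rewrite -e'.
  exists (perm (inv_inj fK)).
    by apply/fpf_involutionP; split=> v; rewrite !permE.
  apply/setP=> A; apply/idP/imsetP=> [Aa|[v _ ->]].
    have /cards2P[x [y [xy e]]] := a2 _ Aa.
    exists x => //; rewrite permE -fE; apply/esym/def_pblock => //.
    by rewrite e set21.
  by rewrite permE -fE.
apply/andP; split; last first.
  by apply/forall_inP=> _ /imsetP[v _ ->]; rewrite cards2 (eq_sym v) sF.
rewrite blocks_equivalence; apply/equivalence_partitionP => x y z _ _ _.
split; first by rewrite set21.
rewrite !inE => /orP[/eqP->//|/eqP->]; rewrite sK orbC.
by [].
Qed.

(** A through block is determined by its upper end. *)
Lemma rank_blocks (n : nat) (s : {perm vertex n}) :
  fpf_involution s -> rank (blocks s) = #|[set i | through s i]|.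
Proof.
move=> /fpf_involutionP[sK sF].
rewrite -(card_in_imset (f := fun i => [set inl i; s (inl i)] : {set vertex n})).
  congr #|pred_of_set _|; apply/setP=> A; rewrite inE; apply/idP/imsetP.
    case/and3P=> As /set0Pn[u /setIP[uA /imsetP[i _ ui]]] /set0Pn[w /setIP[wA /imsetP[j _ wj]]].
    exists i; last by rewrite -ui; exact: block_of.
    move: wA; rewrite (block_of sK As uA) ui !inE wj /= => /eqP e.
    by rewrite /through -e.
  case=> i; rewrite inE /through => ti ->; rewrite mem_blocks /=.
  apply/andP; split; apply/set0Pn.
    by exists (inl i); rewrite inE set21 imset_f.
  by case e: (s (inl i)) ti => [//|j] _; exists (inr j); rewrite inE set22 imset_f.
move=> i j; rewrite !inE /through => ti tj /setP/(_ (inl i)).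
by rewrite !inE eqxx /=; case: (s (inl j)) tj => //= k _; rewrite orbF => /esym/eqP[].
Qed.

Lemma even_invariant (V : finType) (s : {perm V}) (A : {set V}) :
  fpf_involution s -> (forall v, (s v \in A) = (v \in A)) -> ~~ odd #|A|.
Proof.
move=> /fpf_involutionP[sK sF].
have [m] := ubnP #|A|; elim: m A => // m IH A lt_m sA.
have [->|/set0Pn[v vA]] := eqVneq A set0; first by rewrite cards0.
have svA : s v \in A :\ v by rewrite !inE sF sA.
rewrite (cardsD1 v) vA (cardsD1 (s v) (A :\ v)) svA /= negbK.
apply: IH.
  by move: lt_m; rewrite (cardsD1 v) vA (cardsD1 (s v) (A :\ v)) svA !add1n ltnS; exact: ltnW.
move=> w; rewrite !inE sA (inj_eq perm_inj) (can2_eq sK sK).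
by case: (w == v); case: (w == s v).
Qed.

Lemma card_set_sum (T : finType) (A : pred (T + T)) :
  #|[set v | A v]| = (\sum_i A (inl i) + \sum_i A (inr i))%N.
Proof. by rewrite -sum1dep_card big_mkcond big_sumType. Qed.

(** * Idempotent Brauer diagrams *)

Section Idempotent.

Context (n : nat) (s : {perm vertex n}).
Hypothesis s_fpf : fpf_involution s.

Let sK : involutive s. Proof. by case/fpf_involutionP: s_fpf. Qed.
Let sF v : s v != v. Proof. by case/fpf_involutionP: s_fpf => _; apply. Qed.

Let edge : rel (vertex3 n) :=
  fun u v => [set u; v] \in union_edges (blocks s) (blocks s).

Let edge_lower v : edge (lower_to_middle v) (lower_to_middle (s v)).
Proof.
rewrite /edge /union_edges inE; apply/orP; left; apply/imsetP; exists [set v; s v].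
  exact: mem_blocks.
by rewrite imsetU !imset_set1.
Qed.

Let edge_upper v : edge (upper_to_middle v) (upper_to_middle (s v)).
Proof.
rewrite /edge /union_edges inE; apply/orP; right; apply/imsetP; exists [set v; s v].
  exact: mem_blocks.
by rewrite imsetU !imset_set1.
Qed.

Let edge_sym : symmetric edge.
Proof. by move=> u v; rewrite /edge setUC. Qed.

Let connect_symm : connect_sym edge.
Proof. exact: sym_connect_sym edge_sym. Qed.


(** A function constant along the edges coming from either factor is constant on
the components of the product graph. *)
Let connect_ind (L : Type) (phi : vertex3 n -> L) :
  (forall v, phi (lower_to_middle (s v)) = phi (lower_to_middle v)) ->
  (forall v, phi (upper_to_middle (s v)) = phi (upper_to_middle v)) ->
  forall u v, connect edge u v -> phi u = phi v.
Proof.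
move=> phi_l phi_u u v /connectP[p]; elim: p u => [u _ ->//|w p IH u /=].
case/andP=> uw wp vl; rewrite -(IH w wp vl) => {IH wp vl v p}.
have in_edge (f : vertex n -> vertex3 n) x : [set u; w] = [set f x; f (s x)] ->
    phi (f (s x)) = phi (f x) -> phi u = phi w.
  move=> e fx; have := set22 u w; have := set21 u w; rewrite e !inE.
  by move=> /orP[/eqP|/eqP] -> /orP[/eqP|/eqP] ->.
case/setUP: uw => /imsetP[_ /imsetP[x _ ->]]; rewrite imsetU !imset_set1 => e.
  exact: in_edge e _.
exact: in_edge e _.
Qed.

Let joined x y := connect edge (inl x) (inl y).

Let joined_equiv : equivalence_rel joined.
Proof.
move=> x y z; rewrite /joined; split; first exact: connect0.
by move=> xy; apply/idP/idP; apply: connect_trans; rewrite // connect_symm.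
Qed.

Lemma brauer_mul_idem :
  reflect (forall x y, joined x y = (y \in [set x; s x]))
          (brauer_mul (blocks s) (blocks s) == blocks s).
Proof.
have mulE : brauer_mul (blocks s) (blocks s) =
    [set [set y | joined x y] | x : vertex n].
  apply/setP=> A; apply/imsetP/imsetP=> -[v _ ->]; exists v => //;
  by apply/setP=> y; rewrite !inE.
rewrite mulE; apply: (iffP eqP) => [e x y|e].
  have: [set y | joined x y] \in blocks s by rewrite -e imset_f.
  move/(block_of sK)/(_ _)/setP => /(_ x); rewrite inE (joined_equiv x x x).1.
  by move=> /(_ isT y); rewrite inE.
apply/setP=> A; apply/imsetP/imsetP=> -[v _ ->]; exists v => //;
by apply/setP=> y; rewrite inE e.
Qed.

(** Label the column [i] by the component of its middle vertex in the product
graph. Equal labels for two through blocks would join their ends in the square,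
which is the diagram itself. *)
Lemma idem_separated :
  brauer_mul (blocks s) (blocks s) == blocks s -> separated s.
Proof.
move=> /brauer_mul_idem sE.
pose mid i : vertex3 n := inr i.
have mid_eq i j : connect edge (mid i) (mid j) ->
    [set u | connect edge (mid i) u] = [set u | connect edge (mid j) u].
  move=> ij; apply/setP=> u; rewrite !inE.
  by apply/idP/idP; apply: connect_trans; rewrite // connect_symm.
apply: (separatedI (c := fun i => [set u | connect edge (mid i) u])) => [v|i j].
  suff: connect edge (mid (column v)) (mid (column (s v))) by move/mid_eq->.
  (* For a through block, the upper and the lower end are joined in the square,
     hence so are the middle vertices next to them. *)
  have tr i j : s (inl i) = inr j -> connect edge (mid i) (mid j).
    move=> ij.
    have := connect1 (edge_upper (inl i)); rewrite ij => e1.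
    have := connect1 (edge_lower (inl i)); rewrite ij => e2.
    apply: connect_trans e1 _; apply: connect_trans e2.
    rewrite connect_symm.
    by have := sE (inl i) (inr j); rewrite /joined /= => ->; rewrite -ij set22.
  case: v => [i|i]; case e: (s _) => [j|j] /=.
  - by have := connect1 (edge_upper (inl i)); rewrite e.
  - exact: tr.
  - by rewrite connect_symm; apply: tr; rewrite -e sK.
  - by have := connect1 (edge_lower (inr i)); rewrite e.
rewrite /through.
case ei: (s (inl i)) => [//|i'] _; case ej: (s (inl j)) => [//|j'] _.
move=> /setP/(_ (mid j)); rewrite !inE connect0 => ij.
have := connect1 (edge_upper (inl i)); rewrite ei connect_symm => e1.
have := connect1 (edge_upper (inl j)); rewrite ej => e2.
have := connect_trans (connect_trans e1 ij) e2.
have /= := sE (inr i') (inr j'); rewrite /joined => -> /=.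
rewrite !inE -ei sK /= orbF -ej => /eqP /perm_inj [].
by [].
Qed.

(** The labelling, refined by the blocks that are not through, is constant along
the product graph and separates the blocks of [s]; so two end points joined in
the square form a block. Counting end points modulo 2 gives the converse: the
part of a component covered by either factor is invariant under a
fixed-point-free involution, hence even, and middle vertices are counted
twice. *)
Lemma separated_idem :
  separated s -> brauer_mul (blocks s) (blocks s) == blocks s.
Proof.
move=> /separatedE[c [cs c_inj]].
pose crossing v := is_lower v != is_lower (s v).
have crossing_s v : crossing (s v) = crossing v by rewrite /crossing sK eq_sym.
pose phi (u : vertex3 n) : 'I_n + {set vertex n} :=
  match u with
  | inl v => if crossing v then inl (c (column v)) else inr [set v; s v]
  | inr i => inl (c i)
  end.
have phi_l v : phi (lower_to_middle (s v)) = phi (lower_to_middle v).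
  have := cs v; case: v => i; case e: (s _) => [j|j] /= cij;
    have e' := esym (canRL sK e); rewrite /crossing ?e ?e' //= ?cij //.
  by rewrite setUC.
have phi_u v : phi (upper_to_middle (s v)) = phi (upper_to_middle v).
  have := cs v; case: v => i; case e: (s _) => [j|j] /= cij;
    have e' := esym (canRL sK e); rewrite /crossing ?e ?e' //= ?cij //.
  by rewrite setUC.
have crossingE v : crossing v ->
    exists2 i, through s i & v \in [set inl i; s (inl i)].
  rewrite /crossing /through; case: v => i.
    by rewrite eq_sym eqbF_neg negbK => ti; exists i; rewrite ?set21.
  case e: (s _) => [j|j] //= _; exists j; rewrite -e sK //.
  by rewrite set22.
have inside x y : joined x y -> y \in [set x; s x].
  move=> /(connect_ind phi_l phi_u) /=.
  case: ifP => tx; case: ifP => ty //; last by move=> [->]; rewrite set21.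
  have [i ti xi] := crossingE x tx; have [j tj yj] := crossingE y ty.
  have cE v k : v \in [set inl k; s (inl k)] -> c (column v) = c k.
    by rewrite !inE => /orP[/eqP->|/eqP->] //; rewrite cs.
  rewrite (cE _ _ xi) (cE _ _ yj) => -[/(c_inj _ _ ti tj) ij]; subst j.
  move: xi yj; rewrite !inE => /orP[/eqP->|/eqP->]; rewrite ?sK //.
  by rewrite orbC.
apply/brauer_mul_idem => x y; apply/idP/idP; first exact: inside.
rewrite !inE => /orP[/eqP->|/eqP->]; first by rewrite (joined_equiv x x x).1.
pose C := [set u | connect edge (inl x) u].
have evenC (f : vertex n -> vertex3 n) :
    (forall v, edge (f v) (f (s v))) -> ~~ odd #|[set v | f v \in C]|.
  move=> fe; apply: (even_invariant s_fpf) => v; rewrite !inE.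
  have fv := connect1 (fe v).
  apply/idP/idP => h; apply: connect_trans h _ => //.
  by rewrite connect_symm.
have := evenC _ edge_lower; have := evenC _ edge_upper.
have : odd #|[set v | inl v \in C]| = odd #|[set v | upper_to_middle v \in C]|
    (+) odd #|[set v | lower_to_middle v \in C]|.
  rewrite !card_set_sum /= !oddD.
  by case: (odd _); case: (odd _); case: (odd _).
move=> even_joined /negPf up /negPf low; rewrite up low /= in even_joined.
apply/negPn/negP => not_joined.
suff : [set v | inl v \in C] = [set x] by move=> e; rewrite e cards1 in even_joined.
apply/setP=> z; rewrite !inE; apply/idP/eqP => [xz|->]; last exact: connect0.
have := inside _ _ xz; rewrite !inE => /orP[/eqP//|/eqP e].
by rewrite e in xz; rewrite /joined xz in not_joined.
Qed.

End Idempotent.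

(** * Removing an upper block from an idempotent *)

(** Idempotents of rank [r] on the columns in [S], as permutations of all the
vertices which fix those outside [S]: the set of columns can then shrink while
the type of vertices stays the same. *)
Definition diagrams (T : finType) (S : {set T}) (r : nat) : {set {perm T + T}} :=
  [set s : {perm T + T} | [&& [forall v, s (s v) == v],
               [forall v, (s v == v) == (column v \notin S)],
               separated s & #|[set i | through s i]| == r]].

Section Diagrams.

Context (T : finType).
Implicit Types (S : {set T}) (r : nat) (s : {perm T + T}) (u v w : T + T).

Lemma diagramsP S r s :
  reflect [/\ involutive s, forall v, (s v == v) = (column v \notin S),
              separated s & #|[set i | through s i]| = r]
          (s \in diagrams S r).
Proof.
rewrite inE; apply: (iffP and4P).
  case=> /forallP sK /forallP sS sep /eqP sr.
  by split=> //; [move=> v; apply/eqP/sK | move=> v; exact: eqP (sS v)].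
case=> sK sS sep sr; split=> //; last exact/eqP.
  by apply/forallP=> v; rewrite sK eqxx.
by apply/forallP=> v; rewrite sS eqxx.
Qed.

Lemma column_stable S r s v : s \in diagrams S r ->
  (column (s v) \in S) = (column v \in S).
Proof.
case/diagramsP=> sK sS _ _; apply: negb_inj.
by rewrite -!sS sK eq_sym.
Qed.

Lemma through_sub S r s : s \in diagrams S r -> [set i | through s i] \subset S.
Proof.
case/diagramsP=> sK sS _ _; apply/subsetP=> i; rewrite inE /through.
by apply: contraTT => iS; have := sS (inl i); rewrite /= iS => /eqP->.
Qed.

Section Pair.

Context (S : {set T}) (r : nat) (x y : T).
Hypotheses (xS : x \in S) (yS : y \in S) (xy : x != y).

Let S' := S :\ x :\ y.

Let in_S' i : (i \in S') = [&& i != y, i != x & i \in S].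
Proof. by rewrite !inE. Qed.

(** Every diagram in [capped] is conjugate by a transposition to one in
[split_off], and these correspond to the diagrams on the other columns. *)
Let capped := [set s in diagrams S r | s (inl x) == inl y].
Let split_off := [set s in capped | s (inr x) == inr y].

Let cappedE s : (s \in capped) = (s \in diagrams S r) && (s (inl x) == inl y).
Proof. by rewrite [LHS]in_set. Qed.

Let split_offP s :
  reflect [/\ s \in diagrams S r, s (inl x) = inl y & s (inr x) = inr y]
          (s \in split_off).
Proof.
apply: (iffP setIdP) => [[/setIdP[D /eqP sx] /eqP sx']|[D sx sx']]; first by split.
by split; [apply/setIdP; split=> //|]; apply/eqP.
Qed.

(** Multiplying by the involution that exchanges the columns [x] and [y] adds the
two blocks {x, y} and {x', y'} to a diagram fixing these four vertices, or takes
them away. *)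
Let swap_fun (v : T + T) : T + T :=
  match v with inl i => inl (tperm x y i) | inr i => inr (tperm x y i) end.

Let swap_funK : involutive swap_fun.
Proof. by case=> i /=; rewrite tpermK. Qed.

Let swap : {perm T + T} := perm (inv_inj swap_funK).

Let swapK : involutive swap.
Proof. by move=> v; rewrite !permE swap_funK. Qed.

Let is_lower_swap v : is_lower (swap v) = is_lower v.
Proof. by rewrite permE; case: v. Qed.

Let in_xy i := (i == x) || (i == y).

Let in_xy_swap v : in_xy (column (swap v)) = in_xy (column v).
Proof.
rewrite permE /in_xy; case: v => i /=; case: tpermP => [->|->|//];
by rewrite !eqxx ?orbT.
Qed.

Let swap_id v : ~~ in_xy (column v) -> swap v = v.
Proof.
rewrite permE /in_xy negb_or; case: v => i /= /andP[ix iy];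
by rewrite tpermD // eq_sym.
Qed.

Let swap_neq v : in_xy (column v) -> swap v != v.
Proof.
rewrite permE /in_xy; case: v => i /= /orP[]/eqP-> /=; rewrite ?tpermL ?tpermR;
by apply: contra xy => /eqP[->].
Qed.

Let through_swap s i : through (s * swap)%g i = through s i.
Proof. by rewrite /through permM is_lower_swap. Qed.

Let stable_xy s v : involutive s ->
  (forall u, in_xy (column u) -> in_xy (column (s u))) ->
  in_xy (column (s v)) = in_xy (column v).
Proof. by move=> sK h; apply/idP/idP => /h; rewrite ?sK. Qed.

Let split_offE s v : s \in split_off -> in_xy (column v) -> s v = swap v.
Proof.
case/split_offP=> /diagramsP[sK _ _ _] sx sx'.
rewrite permE /in_xy; case: v => i /= /orP[]/eqP-> /=; rewrite ?tpermL ?tpermR //.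
  by rewrite -sx sK.
by rewrite -sx' sK.
Qed.

Let split_off_add s : s \in diagrams S' r -> (s * swap)%g \in split_off.
Proof.
case/diagramsP=> sK sS /separatedE[c [cs c_inj]] sr.
have s_id u : in_xy (column u) -> s u = u.
  move=> h; apply/eqP; rewrite sS in_S' andbA -negb_or orbC.
  by move: h; rewrite /in_xy => ->.
have s_xy u : in_xy (column (s u)) = in_xy (column u).
  by apply: stable_xy => // {}u h; rewrite s_id.
have stE u : (s * swap)%g u = if in_xy (column u) then swap u else s u.
  by rewrite permM; case: ifPn => h; [rewrite s_id | rewrite swap_id ?s_xy].
have xx : in_xy x by rewrite /in_xy eqxx.
apply/split_offP; split.
- apply/diagramsP; split.
  + move=> v; rewrite (stE v); case: ifPn => h; rewrite stE.
      by rewrite in_xy_swap h swapK.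
    by rewrite s_xy (negPf h) sK.
  + move=> v; rewrite stE; case: ifPn => h.
      rewrite (negPf (swap_neq h)); apply/esym/negbF.
      by move: h; rewrite /in_xy => /orP[]/eqP->.
    by rewrite sS in_S'; move: h; rewrite /in_xy negb_or => /andP[-> ->].
  + apply: (separatedI (c := fun i => c (if i == y then x else i))).
      move=> v; rewrite stE; case: (boolP (in_xy (column v))) => h.
        have red i : in_xy i -> (if i == y then x else i) = x.
          by rewrite /in_xy; case: (i == y); rewrite ?orbF // => /eqP.
        by rewrite (red _ h) red ?in_xy_swap.
      move: (h); rewrite -s_xy /in_xy negb_or => /andP[_ /negPf->].
      by move: h; rewrite /in_xy negb_or => /andP[_ /negPf->].
    move=> i j; rewrite !through_swap => ti tj.
    have notxy k : through s k -> (k == y) = false.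
      move=> tk; apply/eqP=> e; move: tk.
      by rewrite /through s_id //= /in_xy e eqxx orbT.
    by rewrite !notxy //; apply: c_inj.
  + by rewrite -sr; apply: eq_card => i; rewrite !inE through_swap.
- by rewrite stE /= xx permE /= tpermL.
- by rewrite stE /= xx permE /= tpermL.
Qed.

Let split_off_remove s : s \in split_off -> (s * swap)%g \in diagrams S' r.
Proof.
move=> sO; have sE v : in_xy (column v) -> s v = swap v by apply: split_offE.
case/split_offP: sO => /diagramsP[sK sS /separatedE[c [cs c_inj]] sr] _ _.
have s_xy u : in_xy (column (s u)) = in_xy (column u).
  by apply: stable_xy => // {}u h; rewrite sE ?in_xy_swap.
have stE u : (s * swap)%g u = if in_xy (column u) then u else s u.
  by rewrite permM; case: ifPn => h; [rewrite sE ?swapK | rewrite swap_id ?s_xy].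
apply/diagramsP; split.
- move=> v; rewrite (stE v); case: ifPn => h; rewrite stE ?(negPf h) ?h //.
  by rewrite s_xy (negPf h) sK.
- move=> v; rewrite stE in_S' andbA -negb_or orbC; case: ifPn => h.
    by move: h; rewrite /in_xy eqxx => ->.
  by rewrite sS; move: h; rewrite /in_xy => ->.
- apply: (separatedI (c := c)) => [v|i j]; first by rewrite stE; case: ifP.
  by rewrite !through_swap; apply: c_inj.
by rewrite -sr; apply: eq_card => i; rewrite !inE through_swap.
Qed.

Let card_split_off : #|split_off| = #|diagrams S' r|.
Proof.
have swap2 : (swap * swap)%g = 1%g by apply/permP=> v; rewrite permM perm1 swapK.
rewrite -(card_imset (diagrams S' r) (mulIg swap)).
apply: eq_card => s; apply/idP/imsetP => [sO|[s' s'D ->]]; last exact: split_off_add.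
exists (s * swap)%g; first exact: split_off_remove.
by rewrite -mulgA swap2 mulg1.
Qed.

Let conjE s u w v : (s ^ tperm u w)%g v = tperm u w (s (tperm u w v)).
Proof. by rewrite conjgE tpermV !permM. Qed.

Let conjK s u w : ((s ^ tperm u w) ^ tperm u w = s)%g.
Proof. by rewrite -conjgM tperm2 conjg1. Qed.

Let conj_inv s u w : involutive s -> involutive (s ^ tperm u w)%g.
Proof. by move=> sK v; rewrite !conjE tpermK sK tpermK. Qed.

Let conj_supp s u w : (forall v, (s v == v) = (column v \notin S)) ->
  column u \in S -> column w \in S ->
  forall v, ((s ^ tperm u w)%g v == v) = (column v \notin S).
Proof.
move=> sS uS wS v; rewrite conjE (can2_eq (tpermK _ _) (tpermK _ _)) sS.
by case: tpermP => [->|->|//]; rewrite uS wS.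
Qed.

Let conj_labels (L : Type) (c : T -> L) s u w :
  (forall v, c (column (s v)) = c (column v)) -> c (column u) = c (column w) ->
  forall v, c (column ((s ^ tperm u w)%g v)) = c (column v).
Proof.
move=> cs uw v; have ct z : c (column (tperm u w z)) = c (column z).
  by case: tpermP => [->|->|//].
by rewrite conjE ct cs ct.
Qed.

(** A diagram [s] with upper block {x, y} is recovered from the split-off diagram
obtained by conjugating with the transposition of [w = s (inr y)] and [inr x],
together with [w]. The possible [w] are [inr x], which leaves the diagram split,
and the vertices of the other columns, except that [w] and its partner in the
split-off diagram may not both be upper: otherwise [s] would have two through
blocks ending at x' and y', in one component. *)
Let targets s : {set T + T} :=
  [set w | (w == inr x) || ((column w \in S') && (is_lower w || is_lower (s w)))].

Let targetsP s w : reflect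
  (w = inr x \/ column w \in S' /\ is_lower w || is_lower (s w)) (w \in targets s).
Proof.
rewrite [w \in targets s]in_set; apply: (iffP orP) => [[/eqP->|/andP[]]|[->|[wS' lw]]]; auto.
by right; apply/andP.
Qed.

(** If [w] is upper, its partner is lower and moves to [inr x], while [w] becomes
the partner of [inr y]; if [w] is lower, only lower ends move. Either way the
upper ends of through blocks stay the same. *)
Let through_conj s w i : involutive s -> s (inr x) = inr y -> w \in targets s ->
  through (s ^ tperm w (inr x))%g i = through s i.
Proof.
move=> sK sx' /targetsP[->|[wS' lw]].
  by rewrite /through conjE tperm1 !perm1.
have sy' : s (inr y) = inr x by rewrite -sx' sK.
rewrite /through conjE; have [e|iw] := eqVneq (inl i) w.
  rewrite e tpermL sx' tpermD; last 2 first.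
  - by apply: contraTneq wS' => ->; rewrite in_S' eqxx.
  - by apply: contra xy => /eqP[->].
  by move: lw; rewrite -e.
rewrite (tpermD (z := inl i)) 1?eq_sym //.
case: tpermP => [e|e|//].
  by move: lw; rewrite -e sK e orbF => ->.
by move: sx'; rewrite -e sK.
Qed.

(** After the conjugation, [x] and [y] lie in the component of [w]; since none of
their vertices is the upper end of a through block, relabelling these two columns
cannot identify two through blocks. *)
Let capped_conj s w : s \in split_off -> w \in targets s ->
  (s ^ tperm w (inr x))%g \in capped /\ (s ^ tperm w (inr x))%g (inr y) = w.
Proof.
case/split_offP=> /diagramsP[sK sS /separatedE[c [cs c_inj]] sr] sx sx' wt.
have tE i := through_conj i sK sx' wt.
have sy' : s (inr y) = inr x by rewrite -sx' sK.
have [wS wy] : column w \in S /\ inr y != w.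
  case/targetsP: wt => [->|[]].
    by split=> //; apply: contra xy => /eqP[->].
  rewrite in_S' => /and3P[wy wx wS] _; split=> //.
  by apply: contra wy => /eqP<-.
have wU i : in_xy i -> inl i != w.
  case/targetsP: wt => [->//|[wS' _]] ixy.
  apply: contraTneq wS' => <-; rewrite in_S' /= andbA -negb_or orbC.
  by move: ixy; rewrite /in_xy => ->.
have pq : inr x != inr y :> T + T by apply: contra xy => /eqP[->].
split; last by rewrite conjE (tpermD _ pq) 1?eq_sym // sy' tpermR.
rewrite cappedE; apply/andP; split; last first.
  have xE : in_xy x by rewrite /in_xy eqxx.
  have yE : in_xy y by rewrite /in_xy eqxx orbT.
  by rewrite conjE [tperm _ _ (inl x)]tpermD ?sx ?tpermD // eq_sym wU.
apply/diagramsP; split.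
- exact: conj_inv.
- exact: conj_supp.
- pose d i := if in_xy i then c (column w) else c i.
  have cyx : c y = c x by have := cs (inl x); rewrite sx.
  have s_xy u : in_xy (column (s u)) = in_xy (column u).
    apply: stable_xy => // {}u; rewrite /in_xy.
    have sy : s (inl y) = inl x by rewrite -sx sK.
    by case: u => i /= /orP[]/eqP->; rewrite ?sx ?sx' ?sy ?sy' /= eqxx ?orbT.
  apply: (separatedI (c := d)).
    apply: conj_labels => [v|]; first by rewrite /d s_xy; case: ifP.
    by rewrite /d /= {2}/in_xy eqxx /=; case: ifP.
  move=> i j; rewrite !tE => ti tj.
  have notxy k : through s k -> in_xy k = false.
    move=> tk; apply/negP => /orP[]/eqP e; move: tk; rewrite /through e ?sx //.
    by rewrite -sx sK.
  by rewrite /d !notxy //; apply: c_inj.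
by rewrite -sr; apply: eq_card => i; rewrite !inE tE.
Qed.

Let column_neq w k : inl k != w -> inr k != w -> column w != k.
Proof.
by case: w => i h1 h2; apply/eqP=> /= e; [move: h1|move: h2]; rewrite e eqxx.
Qed.

(** The same labelling serves both diagrams, because [w], [inr y], [inl y] and
[inl x] lie in one component of [s]. It also shows that the partners of [inr x]
and [inr y] are not both upper. *)
Let split_off_conj s : s \in capped ->
  let w := s (inr y) in
  (s ^ tperm w (inr x))%g \in split_off /\ w \in targets (s ^ tperm w (inr x))%g.
Proof.
rewrite cappedE => /andP[sD /eqP sx]; set w := s _ => /=.
have [sK sS /separatedE[c [cs c_inj]] sr] := diagramsP _ _ _ sD.
have sw : s w = inr y by rewrite sK.
have sy : s (inl y) = inl x by rewrite -sx sK.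
have wS : column w \in S by rewrite (column_stable _ sD).
have wy : w != inr y by rewrite /w sS yS.
have wux : inl x != w by apply/eqP => e; move: sw; rewrite -e sx.
have wuy : inl y != w by apply/eqP => e; move: sw; rewrite -e sy.
have yx' : inr y != inr x :> T + T by apply: contra xy => /eqP[->].
set s0 := (s ^ _)%g.
have cw : c (column w) = c x.
  by rewrite cs -[column _]/(column (inl y : T + T)) -sx cs.
have wt : w \in targets s0.
  apply/targetsP; have [->|wx] := eqVneq w (inr x); [by left | right].
  split.
    rewrite in_S' wS andbT; apply/andP; split.
      by apply: column_neq; rewrite // eq_sym.
    by apply: column_neq; rewrite // eq_sym.
  case lw : (is_lower w) => //=.
  rewrite /s0 conjE tpermL.
  have lsx : is_lower (s (inr x)).
    case e: (s (inr x)) => [i|//]; case ew : w lw => [j|//] _.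
    have ij : i = j.
      apply: c_inj; first by rewrite /through -e sK.
        by rewrite /through -ew sw.
      by rewrite -[j]/(column (inl j : T + T)) -ew cw -[i]/(column (inl i : T + T)) -e cs.
    by move: yx'; rewrite -sw ew -ij -e sK eqxx.
  rewrite tpermD //; first by apply: contraTneq lsx => <-; rewrite lw.
  by rewrite eq_sym sS xS.
split=> //.
have s0y : s0 (inr y) = inr x.
  by rewrite /s0 conjE (tpermD (z := inr y)) ?tpermL // eq_sym.
have s0x : s0 (inr x) = inr y.
  by rewrite /s0 conjE tpermR sw tpermD // eq_sym.
have s0ux : s0 (inl x) = inl y.
  by rewrite /s0 conjE [tperm _ _ (inl x)]tpermD ?sx ?tpermD // eq_sym.
have s0K : involutive s0 by apply: conj_inv.
have tE i : through s0 i = through s i.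
  by rewrite -(through_conj i s0K s0x wt) /s0 conjK.
apply/split_offP; split=> //; apply/diagramsP; split=> //.
- exact: conj_supp.
- apply: (separatedI (c := c)) => [|i j]; first exact: conj_labels.
  by rewrite !tE; apply: c_inj.
by rewrite -sr; apply: eq_card => i; rewrite !inE tE.
Qed.

(** The lower choices are the vertices of [S] other than [inr y]; the upper ones
are the upper ends of through blocks. *)
Let card_targets s : s \in split_off -> #|targets s| = (#|S| - 1 + r)%N.
Proof.
case/split_offP=> sD sx sx'; have sub := through_sub sD.
have [sK sS _ sr] := diagramsP _ _ _ sD.
have throughS i : through s i -> i \in S'.
  move=> ti; rewrite in_S' (subsetP sub) ?inE // andbT.
  apply/andP; split; apply: contraTneq ti => ->; rewrite /through ?sx //.
  by rewrite -sx sK.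
rewrite card_set_sum addnC; congr (_ + _)%N.
  rewrite (cardsD1 y S) yS addKn -sum1_card [RHS]big_mkcond; apply: eq_bigr => i _.
  rewrite !inE /= andbT (_ : (inr i == inr x :> T + T) = (i == x)) //.
  by case: eqVneq => [->|ix] /=; rewrite ?xy ?xS //; case: (_ && _).
rewrite -sr -sum1dep_card [RHS]big_mkcond; apply: eq_bigr => i _ /=.
by rewrite -/(through s i); case ti: (through s i); rewrite ?andbF ?throughS.
Qed.

Lemma card_diagrams_upper_block : #|capped| = (#|S| - 1 + r) * #|diagrams S' r|.
Proof.
rewrite -card_split_off.
rewrite -sum1_card (partition_big
  (fun s => (s ^ tperm (s (inr y)) (inr x))%g) (mem split_off)) /=; last first.
  by move=> s /split_off_conj[].
rewrite mulnC -sum_nat_const; apply: eq_bigr => s sO.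
rewrite sum1dep_card -(card_targets sO).
rewrite -[RHS](card_in_imset (f := fun w => (s ^ tperm w (inr x))%g)).
  apply: eq_card => s1; rewrite in_set; apply/andP/imsetP => [[s1C /eqP e]|[w wt ->]].
    have [_] := split_off_conj s1C; rewrite e => wt; exists (s1 (inr y)) => //.
    by rewrite -e conjK.
  have [sC sw] := capped_conj sO wt; split=> //.
  by rewrite sw conjK.
move=> w w' wt wt' e.
by rewrite -(capped_conj sO wt).2 e (capped_conj sO wt').2.
Qed.

End Pair.


Lemma diagrams_eq0 S r : #|S| < r -> diagrams S r = set0.
Proof.
move=> Sr; apply/setP=> s; rewrite in_set0; apply/negP => sD.
have := subset_leq_card (through_sub sD); case/diagramsP: sD => _ _ _ ->.
by rewrite leqNgt Sr.
Qed.

(** Both sides count the diagrams with a marked vertex [inl x] in an upper block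
{x, y}. *)
Lemma diagrams_rec S r :
  (#|S| - r) * #|diagrams S r| =
  \sum_(x in S) \sum_(y in S :\ x)
     (#|S| - 1 + r) * #|diagrams (S :\ x :\ y) r|.
Proof.
transitivity (\sum_(s in diagrams S r) #|S :\: [set i | through s i]|).
  rewrite mulnC -sum_nat_const; apply: eq_bigr => s sD.
  rewrite cardsD (setIidPr (through_sub sD)).
  by case/diagramsP: sD => _ _ _ ->.
transitivity (\sum_(s in diagrams S r)
    \sum_(x in S) \sum_(y in S :\ x) (s (inl x) == inl y)).
  apply: eq_bigr => s sD; have [sK sS _ _] := diagramsP _ _ _ sD.
  rewrite -sum1_card big_mkcond [RHS]big_mkcond; apply: eq_bigr => x _.
  rewrite inE; case xS: (x \in S); last by rewrite andbF.
  rewrite andbT inE /through.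
  have := column_stable (inl x) sD; have := sS (inl x); rewrite /= xS.
  case: (s (inl x)) => z /= zx zS; last by rewrite big1.
  have zSx : z \in S :\ x by rewrite !inE zS andbT; apply: contraFneq zx => ->.
  rewrite (bigD1 z) //= eqxx big1 // => y /andP[_ yz].
  by rewrite eq_sym; case: eqP => // -[] /eqP; rewrite (negPf yz).
rewrite [LHS]exchange_big /=; apply: eq_bigr => x xS.
rewrite [LHS]exchange_big /=; apply: eq_bigr => y /setD1P[yx yS].
rewrite -card_diagrams_upper_block // 1?eq_sym //.
by rewrite -sum1dep_card [RHS]big_mkcondr.
Qed.

(** When every column is the upper end of a through block, the labelling is
injective on columns, so each block is a column. *)
Lemma card_diagrams_full S : #|diagrams S #|S| | = 1.
Proof.
pose flip_fun v := if column v \in S then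
  (match v with inl i => inr i | inr i => inl i end) else v.
have flipK : involutive flip_fun.
  by case=> i; rewrite /flip_fun /=; case iS: (i \in S); rewrite /= iS.
pose flip := perm (inv_inj flipK).
have thr i : through flip i = (i \in S).
  by rewrite /through permE /flip_fun /=; case: ifP.
rewrite -(cards1 flip); apply: eq_card => s; rewrite in_set1.
apply/idP/eqP=> [sD|->].
  have sub := through_sub sD; have colS := fun v => column_stable v sD.
  have [sK sS /separatedE[c [cs c_inj]] sr] := diagramsP _ _ _ sD.
  have tS i : through s i = (i \in S).
    by have /eqP<- : [set i | through s i] == S; [rewrite eqEcard sub sr /= | rewrite inE].
  apply/permP=> v; rewrite permE /flip_fun; case: ifPn => vS; last first.
    by apply/eqP; rewrite sS.
  have e : column (s v) = column v by apply: c_inj; rewrite ?tS ?colS.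
  have : s v != v by rewrite sS vS.
  by move: e; case: v {vS} => i; case: (s _) => j /= ->; rewrite ?eqxx.
apply/diagramsP; split.
- by move=> v; rewrite !permE flipK.
- by move=> [] i; rewrite permE /flip_fun /=; case: ifP => //= _; rewrite eqxx.
- apply: (separatedI (c := id)) => // v.
  by rewrite permE /flip_fun; case: v => i /=; case: ifP.
by apply: eq_card => i; rewrite inE thr.
Qed.

End Diagrams.

(** * Weighted sums over integer partitions *)

Local Open Scope ring_scope.

Definition part_weight (i : nat) : rat := if odd i then 1 else i%:R^-1.

Definition weight (n : nat) (s : seq nat) : rat :=
  \prod_(1 <= i < n.+1) (part_weight i ^+ count_mem i s / (count_mem i s)`!%:R).

(** Adding [o] to the number of odd parts expresses the removal of an odd part
without subtracting from [r], which may be 0. *)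
Definition intpart_sum (n r : nat) (o : bool) : rat :=
  \sum_(mu : intpart n | (count odd (parts mu) + o == r)%N) weight n (parts mu).

Lemma intpart_bounds (n : nat) (s : seq nat) :
  is_intpart n s -> {in s, forall i, (0 < i <= n)%N}.
Proof.
case/and3P=> _ s0 /eqP<- i si; rewrite lt0n; apply/andP; split.
  by apply: contraNneq s0 => <-.
by rewrite (perm_sumn (perm_to_rem si)) leq_addr.
Qed.

Lemma weight_perm (n : nat) (s t : seq nat) :
  perm_eq s t -> weight n s = weight n t.
Proof. by move=> /seq.permP e; apply: eq_bigr => i _; rewrite e. Qed.

Lemma weight_widen (m n : nat) (s : seq nat) :
  is_intpart m s -> (m <= n)%N -> weight n s = weight m s.
Proof.
move=> ms mn; rewrite /weight (big_cat_nat (n := m.+1)) //=.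
rewrite [X in _ * X]big1_seq ?mulr1 // => i; rewrite mem_index_iota => /andP[_ /andP[mi _]].
rewrite (count_memPn _) ?expr0 ?fact0 ?divr1 //.
by apply/negP => /(intpart_bounds ms) /andP[_]; rewrite leqNgt mi.
Qed.

(** The multiplicity in front cancels one factor of the factorial. *)
Lemma weight_cons (n i : nat) (s : seq nat) : (0 < i <= n)%N ->
  (count_mem i (i :: s))%:R * weight n (i :: s) = part_weight i * weight n s.
Proof.
move=> i_n; have i_in : i \in index_iota 1 n.+1 by rewrite mem_index_iota.
rewrite /weight !(bigD1_seq i) ?iota_uniq //= !mulrA; congr (_ * _); last first.
  by apply: eq_bigr => j ji; rewrite eq_sym (negPf ji).
rewrite eqxx add1n exprS factS natrM.
have c0 : (count_mem i s).+1%:R != 0 :> rat by rewrite pnatr_eq0.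
have f0 : (count_mem i s)`!%:R != 0 :> rat by rewrite pnatr_eq0 -lt0n fact_gt0.
by field; rewrite f0 nat1r c0.
Qed.

Lemma is_intpart_add_part (n i : nat) (s : seq nat) : (0 < i <= n)%N ->
  is_intpart (n - i) s -> is_intpart n (sort geq (i :: s)).
Proof.
case/andP=> i0 le_in /and3P[_ s0 /eqP ss]; apply/and3P; split.
- by apply: sort_sorted => x y; exact: leq_total.
- by rewrite mem_sort inE negb_or s0 andbT eq_sym -lt0n.
by rewrite (perm_sumn (s2 := i :: s)) ?perm_sort //= ss subnKC.
Qed.

(** Partitions of [n] with a marked part [i] correspond to partitions of
[n - i], by removal of that part. *)
Lemma sum_marked_parts (n r i : nat) : (0 < i <= n)%N ->
  \sum_(mu : intpart n | count odd (parts mu) == r)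
     (mult mu i)%:R * weight n (parts mu) =
  part_weight i * intpart_sum (n - i) r (odd i).
Proof.
move=> i_n; have /fin_all_exists[h hE] : forall nu : intpart (n - i), exists mu : intpart n,
    parts mu = sort geq (i :: parts nu).
  by move=> nu; apply/intpart_onto/is_intpart_add_part/partsP.
have h_perm nu : perm_eq (parts (h nu)) (i :: parts nu).
  by rewrite hE perm_sort.
have geq_trans : transitive geq by move=> x y z xy yz; exact: leq_trans yz xy.
have geq_anti : antisymmetric geq by move=> x y; rewrite andbC => /anti_leq.
have h_inj : injective h.
  move=> nu nu' e; apply: parts_inj.
  apply: (sorted_eq geq_trans geq_anti).
  - by case/and3P: (partsP nu).
  - by case/and3P: (partsP nu').
  by rewrite -(perm_cons i) -(permPl (h_perm nu)) e; exact: h_perm.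
rewrite (bigID (fun mu => i \in parts mu)) /= addrC big1 ?add0r => [|mu]; last first.
  by case/andP=> _ /count_memPn; rewrite /mult => ->; rewrite mul0r.
rewrite (eq_bigl (mem [set h nu | nu in
    [pred nu | (count odd (parts nu) + odd i == r)%N]])); last first.
  move=> mu /=; apply/andP/imsetP => [[mur imu]|[nu]].
    have [|nu nuE] := @intpart_onto (n - i) (rem i (parts mu)).
      have /and3P[so s0 /eqP ss] := partsP mu; apply/and3P; split.
      - exact: (subseq_sorted geq_trans (rem_subseq _ _)).
      - by apply: contra s0; exact: mem_rem.
      by move: ss; rewrite (perm_sumn (perm_to_rem imu)) /= => e; rewrite -(addKn i (sumn _)) e.
    have e : mu = h nu.
      apply: parts_inj; apply: (sorted_eq geq_trans geq_anti).
      - by case/and3P: (partsP mu).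
      - by case/and3P: (partsP (h nu)).
      by rewrite (permPr (h_perm nu)) nuE perm_to_rem.
    exists nu => //; rewrite inE -(eqP mur) e.
    by move/seq.permP: (h_perm nu) => ->; rewrite /= addnC.
  rewrite inE => nur ->; move/seq.permP: (h_perm nu) => hc.
  by rewrite (perm_mem (h_perm nu)) inE eqxx hc /= addnC.
rewrite big_imset /=; last by move=> ? ? _ _; exact: h_inj.
rewrite /intpart_sum mulr_sumr; apply: eq_bigr => nu _.
rewrite /mult (seq.permP (h_perm nu)) (weight_perm _ (h_perm nu)) weight_cons //.
by rewrite (weight_widen (partsP nu)) ?leq_subr.
Qed.

Lemma sum_mult (n : nat) (mu : intpart n) (g : nat -> rat) :
  \sum_(1 <= i < n.+1) g i * (mult mu i)%:R = \sum_(i <- parts mu) g i.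
Proof.
have := intpart_bounds (partsP mu); rewrite /mult.
elim: (parts mu) => [_|x s IH xs].
  by rewrite big_nil big1 // => i _; rewrite mulr0.
rewrite big_cons -IH; last by move=> i si; apply: xs; rewrite inE si orbT.
have x_in : x \in index_iota 1 n.+1 by rewrite mem_index_iota xs ?mem_head.
rewrite (bigD1_seq x) ?iota_uniq //= [in RHS](bigD1_seq x) ?iota_uniq //=.
rewrite eqxx natrD mulrDr mulr1 -addrA; congr (_ + (_ + _)).
by apply: eq_bigr => i ix; rewrite eq_sym (negPf ix).
Qed.

Lemma sum_marked (n r : nat) (g : nat -> rat) :
  \sum_(mu : intpart n | count odd (parts mu) == r)
     (\sum_(i <- parts mu) g i) * weight n (parts mu) =
  \sum_(1 <= i < n.+1) g i * part_weight i * intpart_sum (n - i) r (odd i).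
Proof.
under eq_bigr => mu _ do rewrite -sum_mult mulr_suml.
rewrite exchange_big /= !big_nat; apply: eq_bigr => i /andP[i0 i_n].
rewrite -mulrA -sum_marked_parts ?i0 // mulr_sumr; apply: eq_bigr => mu _.
by rewrite mulrA.
Qed.

Lemma intpart_sumE (n r : nat) :
  intpart_sum n r false =
  \sum_(mu : intpart n | count odd (parts mu) == r) weight n (parts mu).
Proof. by apply: eq_bigl => mu; rewrite addn0. Qed.

Lemma sum_parts (n : nat) (mu : intpart n) :
  \sum_(i <- parts mu) i%:R = n%:R :> rat.
Proof.
by rewrite -natr_sum; congr _%:R; case/and3P: (partsP mu) => _ _ /eqP; rewrite sumnE.
Qed.

Lemma sum_odd (s : seq nat) : \sum_(i <- s) (odd i)%:R = (count odd s)%:R :> rat.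
Proof. by elim: s => [|i s IH]; rewrite ?big_nil ?big_cons /= ?natrD ?IH. Qed.

Lemma intpart_sum_sub_odd (n r : nat) :
  (n%:R - r%:R) * intpart_sum n r false =
  \sum_(1 <= i < n.+1)
    (i%:R - (odd i)%:R) * part_weight i * intpart_sum (n - i) r (odd i).
Proof.
rewrite -sum_marked intpart_sumE mulr_sumr; apply: eq_bigr => mu /eqP e.
by rewrite big_split /= sumrN sum_parts sum_odd e.
Qed.

Lemma intpart_sum_add_odd (n r : nat) :
  (n%:R + r%:R) * intpart_sum n r false =
  \sum_(1 <= i < n.+1)
    (i%:R + (odd i)%:R) * part_weight i * intpart_sum (n - i) r (odd i).
Proof.
rewrite -sum_marked intpart_sumE mulr_sumr; apply: eq_bigr => mu /eqP e.
by rewrite big_split /= sum_parts sum_odd e.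
Qed.

(** The two expansions match term by term under the shift of [i] by 2: for odd [i]
both factors are [i + 1], and for even [i] both are 1. The term [i = 1] of the
first expansion vanishes, and its term [i = 2] is the sum for [n]. *)
Lemma intpart_sum_rec (n r : nat) :
  (n.+2%:R - r%:R) * intpart_sum n.+2 r false =
  (n.+1%:R + r%:R) * intpart_sum n r false.
Proof.
rewrite intpart_sum_sub_odd big_nat_recl // big_nat_recl //= !subrr !mul0r add0r.
have -> : n.+1%:R + r%:R = 1 + (n%:R + r%:R) :> rat by rewrite -nat1r addrA.
rewrite [RHS]mulrDl mul1r intpart_sum_add_odd; congr (_ + _); last first.
  rewrite !big_nat; apply: eq_bigr => i /andP[i0 i_n].
  rewrite subSS negbK; congr (_ * _); rewrite /part_weight /= negbK.
  case: (odd i) => /=; first by rewrite !mulr1 -[i.+2%:R]natr1 addrK natr1.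
  by rewrite subr0 addr0 !divff // pnatr_eq0 -lt0n.
by rewrite subr0 /part_weight /= divff // mul1r subSS subn1.
Qed.

(** Equality forces every part to be 1, which determines the partition when the
number of odd parts is as large as possible. *)
Lemma count_odd_leqif (s : seq nat) : 0%N \notin s ->
  (count odd s <= sumn s ?= iff all (pred1 1%N) s)%N.
Proof.
elim: s => [_|x s IH] /=; first exact: leqif_refl.
rewrite inE negb_or eq_sym => /andP[x0 /IH]; apply: leqif_add.
by case: x x0 => [//|[|x]] _ /=; split=> //; case: odd.
Qed.

Lemma intpart_sum_eq0 (n r : nat) : (n < r)%N -> intpart_sum n r false = 0.
Proof.
move=> nr; rewrite intpart_sumE big_pred0 // => mu; apply/negP => /eqP e.
have /and3P[_ /count_odd_leqif[le _] /eqP ss] := partsP mu.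
by move: le; rewrite e ss leqNgt nr.
Qed.

Lemma intpart_sum_diag (n : nat) : intpart_sum n n false = n`!%:R^-1.
Proof.
have [|mu0 mu0E] := @intpart_onto n (nseq n 1%N).
  rewrite /is_intpart sumn_nseq mul1n eqxx mem_nseq andbF andbT /=.
  by elim: n => //= n; case: n.
rewrite intpart_sumE (big_pred1 mu0) => [|mu].
  case: n mu0 mu0E => [|n] mu0 mu0E; first by rewrite /weight big_geq // invr1.
  rewrite mu0E /weight big_nat_recl // big1_seq => [|i].
    by rewrite mulr1 count_nseq mul1n expr1n div1r.
  rewrite mem_index_iota /= => /andP[i0 _].
  have -> : (1 == i.+1)%N = false by case: i i0.
  by rewrite add0n count_nseq /=; case: i i0 => // i _; rewrite mul0n expr0 fact0 divr1.
apply/eqP/eqP => [e|->]; last by rewrite mu0E count_nseq /= mul1n.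
apply: parts_inj; rewrite mu0E.
have /and3P[_ /count_odd_leqif[_ eq_all] /eqP ss] := partsP mu.
move: eq_all; rewrite e ss eqxx => /esym/all_pred1P mu1.
have size_mu : size (parts mu) = n by move: ss; rewrite {1}mu1 sumn_nseq mul1n.
by rewrite mu1 size_mu.
Qed.

(** * Counting idempotents *)

(** Both sides vanish for [#|S| < r], agree for [#|S| = r], and otherwise satisfy
the same recurrence from [#|S| - 2] to [#|S|]; for [#|S| = 1] the recurrence
says that both are 0. *)
Lemma card_diagrams (T : finType) (S : {set T}) (r : nat) :
  #|diagrams S r|%:R = #|S|`!%:R * intpart_sum #|S| r false.
Proof.
have [m] := ubnP #|S|; elim: m S => // m IH S; rewrite ltnS => le_S.
have [lt_S|gt_S|eq_S] := ltngtP #|S| r.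
- by rewrite diagrams_eq0 // cards0 intpart_sum_eq0 // mulr0.
- have := congr1 (fun k => k%:R : rat) (diagrams_rec S r).
  have nz : #|S|%:R - r%:R != 0 :> rat by rewrite subr_eq0 eqr_nat gtn_eqF.
  rewrite natrM natrB ?(ltnW gt_S) // => e; apply: (mulfI nz); rewrite e {e}.
  have card1 x : x \in S -> #|S :\ x| = #|S|.-1.
    by move=> xS; rewrite [in RHS](cardsD1 x) xS.
  have card2 x y : x \in S -> y \in S :\ x -> #|S :\ x :\ y| = #|S|.-2.
    by move=> xS yS; rewrite -(card1 x xS) [in RHS](cardsD1 y) yS.
  have S0 : (0 < #|S|)%N by exact: leq_ltn_trans gt_S.
  transitivity (\sum_(x in S) \sum_(y in S :\ x)
      ((#|S|.-1%:R + r%:R) * ((#|S|.-2)`!%:R * intpart_sum #|S|.-2 r false) : rat)).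
    rewrite natr_sum; apply: eq_bigr => x xS; rewrite natr_sum; apply: eq_bigr => y yS.
    rewrite natrM natrD subn1 IH ?card2 //.
    by apply: leq_trans le_S; rewrite -subn2 ltn_subrL.
  under eq_bigr => x xS do rewrite sumr_const (card1 x xS).
  rewrite sumr_const -mulrnA -[LHS]mulr_natl.
  case: #|S| gt_S => [|[|k]] // gt_k.
    by rewrite [RHS]mulrCA intpart_sum_sub_odd big_nat1 subrr mul0n !mul0r mulr0.
  rewrite [RHS]mulrCA intpart_sum_rec /= !factS !natrM.
  by ring.
by rewrite -eq_S card_diagrams_full intpart_sum_diag divff // pnatr_eq0 -lt0n fact_gt0.
Qed.

Lemma num_idem_diagrams (n r : nat) :
  num_idem (brauer_rank n r) = #|diagrams [set: 'I_n] r|.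
Proof.
rewrite -(card_in_imset (f := @blocks (vertex n))).
  apply: eq_card => a; rewrite in_set; apply/andP/imsetP.
    case=> /setIdP[]; rewrite brauer_blocks => /imsetP[s sF ->] /eqP sr sI.
    have [sK sN] := fpf_involutionP _ sF.
    exists s => //; apply/diagramsP; split=> //.
    - by move=> v; rewrite inE (negPf (sN v)).
    - exact: idem_separated.
    by rewrite -rank_blocks.
  case=> s /diagramsP[sK sS sep sr] ->.
  have sF : fpf_involution s.
    by apply/fpf_involutionP; split=> // v; rewrite sS inE.
  split; last exact: separated_idem.
  apply/setIdP; split; last by rewrite rank_blocks // sr.
  by rewrite brauer_blocks; apply: imset_f.
move=> s t /diagramsP[sK sS _ _] /diagramsP[tK tS _ _].
by apply: blocks_inj; apply/fpf_involutionP; split=> // v; rewrite ?sS ?tS inE.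
Qed.

Lemma num_idem_ranks (n : nat) :
  num_idem (brauer n) = (\sum_(r < n.+1) num_idem (brauer_rank n r))%N.
Proof.
have lt_rank a : a \in brauer n -> (rank a < n.+1)%N.
  rewrite brauer_blocks => /imsetP[s sF ->]; rewrite rank_blocks // ltnS.
  by rewrite -[X in (_ <= X)%N]card_ord max_card.
rewrite /num_idem -sum1_card.
rewrite (partition_big (fun a => inord (rank a) : 'I_n.+1) xpredT) //=.
apply: eq_bigr => r _; rewrite sum1dep_card; apply: eq_card => a.
rewrite [LHS]in_set; apply/andP/setIdP.
  case=> /setIdP[aB aI] /eqP<-; split=> //; apply/setIdP; split=> //.
  by rewrite inordK ?lt_rank.
case=> /setIdP[aB /eqP ra] aI; split; first exact/setIdP.
by rewrite -val_eqE /= inordK ?lt_rank // ra.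
Qed.

Lemma prod_even (n : nat) (h : nat -> rat) :
  \prod_(1 <= i < n.+1) (if odd i then 1 else h i) =
  \prod_(1 <= j < (n %/ 2).+1) h (2 * j)%N.
Proof.
rewrite divn2; elim: n => [|n IH]; first by rewrite !big_geq.
rewrite big_nat_recr //= IH uphalf_half; case n_odd: (odd n) => /=; last by rewrite mulr1.
rewrite add1n [RHS]big_nat_recr //=; congr (_ * h _).
by rewrite mul2n doubleS -[in LHS](odd_double_half n) n_odd.
Qed.

Lemma quotient_weightE (n : nat) (mu : intpart n) :
  n`!%:R / ((\prod_(1 <= i < n.+1) (mult mu i)`!%:R) *
            (\prod_(1 <= j < (n %/ 2).+1) (2 * j)%:R ^+ mult mu (2 * j))) =
  n`!%:R * weight n (parts mu).
Proof.
congr (_ * _); rewrite /weight big_split /= prodfV mulrC invfM; congr (_ * _).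
rewrite -(prod_even n (fun i => i%:R ^+ mult mu i)) -prodfV; apply: eq_bigr => i _.
by rewrite /part_weight; case: (odd i); rewrite ?expr1n ?invr1 // exprVn.
Qed.

Lemma sum_odd_mult (n : nat) (mu : intpart n) :
  (\sum_(1 <= i < n.+1 | odd i) mult mu i)%N = count odd (parts mu).
Proof.
apply/eqP; rewrite -(eqr_nat rat) -sum_odd -sum_mult natr_sum big_mkcond /=.
by apply/eqP/eq_bigr => i _; case: (odd i); rewrite ?mul1r ?mul0r.
Qed.

Theorem theorem18 (n : nat) :
  let k := (n %/ 2)%N in
  (num_idem (brauer n))%:R =
    \sum_(mu : intpart n)
       n`!%:R / ((\prod_(1 <= i < n.+1) (mult mu i)`!%:R) *
                 (\prod_(1 <= j < k.+1) (2 * j)%:R ^+ mult mu (2 * j))) :> rat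
  /\
  forall r : nat, (r <= n)%N ->
    (num_idem (brauer_rank n r))%:R =
      \sum_(mu : intpart n | (\sum_(1 <= i < n.+1 | odd i) mult mu i == r)%N)
         n`!%:R / ((\prod_(1 <= i < n.+1) (mult mu i)`!%:R) *
                   (\prod_(1 <= j < k.+1) (2 * j)%:R ^+ mult mu (2 * j))) :> rat.
Proof.
move=> k.
have by_rank r : (num_idem (brauer_rank n r))%:R =
    n`!%:R * \sum_(mu : intpart n | count odd (parts mu) == r) weight n (parts mu).
  by rewrite num_idem_diagrams card_diagrams cardsT card_ord intpart_sumE.
split=> [|r _].
  under eq_bigr => mu _ do rewrite quotient_weightE.
  rewrite -mulr_sumr num_idem_ranks natr_sum.
  under eq_bigr => r _ do rewrite by_rank.
  rewrite -mulr_sumr; congr (_ * _); symmetry.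
  rewrite (partition_big (fun mu => inord (count odd (parts mu)) : 'I_n.+1) xpredT) //=.
  apply: eq_bigr => r _; apply: eq_bigl => mu.
  have /and3P[_ /count_odd_leqif[le _] /eqP ss] := partsP mu.
  by rewrite -val_eqE /= inordK // ltnS -[X in (_ <= X)%N]ss.
rewrite by_rank mulr_sumr; apply: eq_big => [mu|mu _]; first by rewrite sum_odd_mult.
by rewrite quotient_weightE.
Qed.
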